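(* There exist positive elliptic-elliptic rotopulsator solutions $q_1,\ldots,q_n$ of the curved $n$-body problem on $\mathbb{S}^3$ for which $r_i$ and $\rho_i$ are independent of $i$, the vectors $(q_{i1},q_{i2})^T$, $i\in\{1,\ldots,n\}$, represent the vertices of a regular polygon, the vectors $(q_{i3},q_{i4})^T$, $i\in\{1,\ldots,n\}$, represent the vertices of a regular polygon, and the masses are all equal. Such solutions exist both for the case that $r_i$ is constant and independent of $i$ and for the case that $r_i$ is nonconstant and independent of $i$.
   Context: Curved $n$-body problem on $\mathbb{S}^3=\{x\in\mathbb{R}^4\mid x_1^2+x_2^2+x_3^2+x_4^2=1\}$ (the case of curvature sign $\sigma=1$): find functions $q_1,\ldots,q_n$ of time with values in $\mathbb{S}^3$, with masses $m_1,\ldots,m_n>0$, solving $$\ddot q_i=\sum_{j=1,\,j\neq i}^{n}\frac{m_j\,(q_j-\langle q_i,q_j\rangle q_i)}{(1-\langle q_i,q_j\rangle^2)^{3/2}}-\langle\dot q_i,\dot q_i\rangle q_i,\qquad i\in\{1,\ldots,n\},$$ where $\langle\cdot,\cdot\rangle$ is the Euclidean inner product on $\mathbb{R}^4$. For a solution the right-hand side has to be defined, i.e. $\langle q_i,q_j\rangle^2\neq 1$ for $i\neq j$. Positive elliptic-elliptic rotopulsator: a solution $q_1,\ldots,q_n$ of this system, $q_i=(q_{i1},q_{i2},q_{i3},q_{i4})^T$, for which there exist nonnegative scalar functions of time $r_i,\rho_i$ with $r_i^2+\rho_i^2=1$, scalar functions of time $\theta,\phi$ (not depending on $i$) and constants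 $\alpha_i,\beta_i\in\mathbb{R}$ such that $$\begin{pmatrix} q_{i1} \\ q_{i2} \end{pmatrix}=r_i\begin{pmatrix}\cos(\theta+\alpha_i)\\ \sin(\theta+\alpha_i)\end{pmatrix},\qquad \begin{pmatrix} q_{i3} \\ q_{i4} \end{pmatrix}=\rho_i\begin{pmatrix}\cos(\phi+\beta_i)\\ \sin(\phi+\beta_i)\end{pmatrix},\qquad i\in\{1,\ldots,n\}$$ (the $\alpha_i$ are not required to be all the same value, and likewise for the $\beta_i$). Terminology on polygons: not necessarily distinct vectors $v_1,\ldots,v_p\in\mathbb{R}^2$ are said to represent the vertices of a polygon with $k$ vertices if the set $\{v_1,\ldots,v_p\}$ consists of exactly $k$ distinct vectors, which are the vertices of that polygon. The statement asserts existence for some number $n\geq 2$ of bodies and suitable masses. *)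

(* Defs.v *)
From mathcomp Require Import all_boot all_order all_algebra.
From mathcomp Require Import all_classical all_reals all_analysis.

Set Implicit Arguments.
Unset Strict Implicit.
Unset Printing Implicit Defensive.
Import Order.TTheory GRing.Theory Num.Theory.
Import numFieldNormedType.Exports.

Local Open Scope classical_set_scope.
Local Open Scope ring_scope.

Definition dot (R : realType) d (x y : 'cV[R]_d) : R :=
  \sum_(k < d) x k 0 * y k 0.

Definition sphere3 (R : realType) : set 'cV[R]_4 := [set x | dot x x = 1].

(* (x_1, x_2)^T and (x_3, x_4)^T *)
Definition plane12 (R : realType) (x : 'cV[R]_4) : 'cV[R]_2 :=
  @usubmx R 2 2 1 x.
Definition plane34 (R : realType) (x : 'cV[R]_4) : 'cV[R]_2 :=
  @dsubmx R 2 2 1 x.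

(* (cos a, sin a)^T *)
Definition cis (R : realType) (a : R) : 'cV[R]_2 :=
  \col_(k < 2) if k == 0 then cos a else sin a.

(* Time ranges over the whole real line. *)
Definition nbody_solution (R : realType) (n : nat) (m : 'I_n -> R)
    (q : 'I_n -> R -> 'cV[R]_4) : Prop :=
  [/\ forall i t, sphere3 (q i t),
      forall i j t, j != i -> dot (q i t) (q j t) ^+ 2 != 1,
      forall i t, derivable (q i) t 1 /\ derivable (derive1 (q i)) t 1 &
      forall i t,
        derive1 (derive1 (q i)) t =
          (\sum_(j < n | j != i)
             (m j / (1 - dot (q i t) (q j t) ^+ 2) `^ (3 / 2)) *:
               (q j t - dot (q i t) (q j t) *: q i t))
          - dot (derive1 (q i) t) (derive1 (q i) t) *: q i t].

(* The radii r and rho are parameters, so that one can speak about them; they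
   are determined by q, being the norms of its two planar projections. *)
Definition positive_elliptic_elliptic_rotopulsator (R : realType) (n : nat)
    (m : 'I_n -> R) (q : 'I_n -> R -> 'cV[R]_4) (r rho : 'I_n -> R -> R) :
    Prop :=
  [/\ forall i, 0 < m i,
      nbody_solution m q,
      forall i t, [/\ 0 <= r i t, 0 <= rho i t &
                      r i t ^+ 2 + rho i t ^+ 2 = 1] &
      exists (theta phi : R -> R) (alpha beta : 'I_n -> R), forall i t,
        plane12 (q i t) = r i t *: cis (theta t + alpha i) /\
        plane34 (q i t) = rho i t *: cis (phi t + beta i)].

(* k >= 3 points equally spaced on a circle of positive radius *)
Definition regular_polygon (R : realType) (k : nat) (w : 'I_k -> 'cV[R]_2) :
    Prop :=
  (3 <= k)%N /\
  exists (c : 'cV[R]_2) (s omega : R), 0 < s /\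
    forall j : 'I_k, w j = c + s *: cis (omega + 2 * pi * j%:R / k%:R).

(* The v i need not be distinct and may enumerate the vertices in any order. *)
Definition represents_vertices (R : realType) (p k : nat)
    (v : 'I_p -> 'cV[R]_2) (w : 'I_k -> 'cV[R]_2) : Prop :=
  injective w /\ range v = range w.

Definition represents_regular_polygon (R : realType) (p : nat)
    (v : 'I_p -> 'cV[R]_2) : Prop :=
  exists (k : nat) (w : 'I_k -> 'cV[R]_2),
    regular_polygon w /\ represents_vertices v w.

Definition equal_mass_polygonal_rotopulsator (R : realType) (n : nat)
    (m : 'I_n -> R) (q : 'I_n -> R -> 'cV[R]_4) (r rho : 'I_n -> R -> R) :
    Prop :=
  [/\ positive_elliptic_elliptic_rotopulsator m q r rho,
      forall i j t, r i t = r j t /\ rho i t = rho j t,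
      forall t, represents_regular_polygon (fun i => plane12 (q i t)),
      forall t, represents_regular_polygon (fun i => plane34 (q i t)) &
      forall i j, m i = m j].

Definition constant_fun (R : realType) (f : R -> R) : Prop :=
  exists c : R, forall t, f t = c.

(* Main.v *)
(** Let three equal masses have pairwise inner products -1/2 at all times. Then
    the sum of their positions vanishes, hence so do all forces, and the bodies
    may travel along great circles at unit speed. Regard R^4 as C^2, take a unit
    speed great circle t |-> (z_1 t, z_2 t), and let the three bodies be its
    images under the rotations (w z_1, w z_2) with w^3 = 1: the mutual inner
    products are Re w = -1/2, and both planar projections are equilateral
    triangles. Choose z_1 t = a cos t + i b sin t, z_2 t = c cos t + i d sin t
    with a^2 + c^2 = b^2 + d^2 = 1, so that r = |z_1| is constant if a = b
    and nonconstant otherwise. *)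

Require Import Defs.
From mathcomp Require Import all_boot all_order all_algebra.
From mathcomp Require Import all_classical all_reals all_analysis.
From mathcomp Require Import ring lra.
Import Order.TTheory GRing.Theory Num.Theory.
Import numFieldNormedType.Exports.

Local Open Scope ring_scope.

Section Dot.
Context {R : realType} {d : nat}.
Implicit Types (x y z : 'cV[R]_d) (a : R).

Lemma dotC x y : dot x y = dot y x.
Proof. by apply: eq_bigr => k _; rewrite mulrC. Qed.

Lemma dotDl x y z : dot (x + y) z = dot x z + dot y z.
Proof.
by rewrite /dot -big_split; apply: eq_bigr => k _; rewrite mxE mulrDl.
Qed.

Lemma dotZl a x y : dot (a *: x) y = a * dot x y.
Proof. by rewrite /dot mulr_sumr; apply: eq_bigr => k _; rewrite mxE mulrA. Qed.

Lemma dotDr x y z : dot x (y + z) = dot x y + dot x z.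
Proof. by rewrite dotC dotDl !(dotC x). Qed.

Lemma dotZr a x y : dot x (a *: y) = a * dot x y.
Proof. by rewrite dotC dotZl dotC. Qed.

Definition dotE := (dotDl, dotDr, dotZl, dotZr).

End Dot.

Lemma dot_col_mx (R : realType) (d e : nat) (x x' : 'cV[R]_d) (y y' : 'cV[R]_e) :
  dot (col_mx x y) (col_mx x' y') = dot x x' + dot y y'.
Proof.
rewrite /dot big_split_ord; congr (_ + _); apply: eq_bigr => k _ /=.
  by rewrite !col_mxEu.
by rewrite !col_mxEd.
Qed.

(** * Angles in the plane *)

Section Cis.
Context {R : realType}.
Implicit Types (a b x y : R).

Lemma dot_cis a b : dot (cis a) (cis b) = cos (a - b).
Proof. by rewrite /dot big_ord_recr big_ord1 /= !mxE/= cosB. Qed.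

Lemma cisD a b : cis (a + b) = cos a *: cis b + sin a *: cis (b + pi / 2).
Proof.
apply/colP => k; rewrite !mxE; case: ifP => _.
  by rewrite cosD cosDpihalf mulrN.
by rewrite sinD sinDpihalf addrC.
Qed.

(** The angle is chosen before [a]: all bodies must share one [theta], and they differ only by the
    rotation [a]. *)
Lemma polar_coordinates x y : exists theta, forall a,
  x *: cis a + y *: cis (a + pi / 2) = Num.sqrt (x ^+ 2 + y ^+ 2) *: cis (theta + a).
Proof.
set s := Num.sqrt _.
suff [theta [xE yE]] : exists theta, x = s * cos theta /\ y = s * sin theta.
  by exists theta => a; rewrite (cisD theta) scalerDr !scalerA -xE -yE.
have ge0 : 0 <= x ^+ 2 + y ^+ 2 by rewrite addr_ge0 ?sqr_ge0.
have s2 : s ^+ 2 = x ^+ 2 + y ^+ 2 by rewrite sqr_sqrtr.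
have [s0|s_neq0] := eqVneq s 0.
  exists 0; move: s2; rewrite s0 !mul0r expr0n => /esym/eqP.
  by rewrite paddr_eq0 ?sqr_ge0// !sqrf_eq0 => /andP[/eqP-> /eqP->].
have s_gt0 : 0 < s by rewrite lt_def s_neq0 sqrtr_ge0.
have xs : -1 <= x / s <= 1.
  rewrite ler_pdivlMr// ler_pdivrMr// mulN1r mul1r -ler_norml -sqrtr_sqr.
  by rewrite ler_wsqrtr// lerDl sqr_ge0.
have sinx : Num.sqrt (1 - (x / s) ^+ 2) = `|y| / s.
  have -> : 1 - (x / s) ^+ 2 = (y / s) ^+ 2.
    have y2 : y ^+ 2 = s ^+ 2 - x ^+ 2 by rewrite s2; ring.
    by rewrite !exprMn y2; field.
  by rewrite sqrtr_sqr normrM normfV (gtr0_norm s_gt0).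
have xE : x = s * cos (acos (x / s)) by rewrite acosK ?in_itv//=; field.
(* [acos] takes values in [0, pi], where the sine is nonnegative, so a negative [y] calls for the
   opposite angle. *)
case: (leP 0 y) => y0.
  exists (acos (x / s)); split=> //.
  by rewrite sin_acos// sinx ger0_norm//; field.
exists (- acos (x / s)); rewrite cosN sinN; split=> //.
by rewrite sin_acos// sinx ltr0_norm//; field.
Qed.

End Cis.

(** * The equilateral triangle *)

Section Triangle.
Context {R : realType}.

(** Shaped like the angles in [regular_polygon] with k = 3, so that the two agree by conversion. *)
Definition third (i : 'I_3) : R := 2 * pi * i%:R / 3%:R.

(** As 3a = 2 pi, the triple angle formula makes c = cos a a root of 4c^3 - 3c - 1 = (c - 1)(2c +
    1)^2, and c < 0 excludes the root 1. *)
Lemma cos_2pi3 : cos (2 * pi / 3) = - 2^-1 :> R.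
Proof.
set a : R := _ / _.
have c1 : cos (a + a *+ 2) = 1.
  by rewrite -cos2pi; congr cos; rewrite /a; field.
have cN : cos a < 0.
  rewrite -(subrK (pi / 2) a) cosDpihalf oppr_lt0 sin_gt0_pi//.
  by have := @pi_gt0 R; rewrite /a; lra.
move: c1; rewrite cosD cos_mulr2n sin_mulr2n.
have := cos2Dsin2 a.
move: (cos a) (sin a) cN => c s cN cs1 c1.
have : (c - 1) * (2 * c + 1) ^+ 2 = 0.
  transitivity (c * (c ^+ 2 *+ 2 - 1) - s * (c * s *+ 2) - 1
                + 2 * c * (c ^+ 2 + s ^+ 2 - 1)); first by ring.
  by rewrite c1 cs1 !subrr mulr0 addr0.
by move=> /eqP; rewrite mulf_eq0 sqrf_eq0 => /orP[] /eqP; lra.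
Qed.

Lemma cos_third i j : j != i -> cos (third i - third j) = - 2^-1 :> R.
Proof.
have c2 : cos (4 * pi / 3) = - 2^-1 :> R.
  have -> : 4 * pi / 3 = (2 * pi / 3) *+ 2 :> R by field.
  by rewrite cos_mulr2n cos_2pi3; field.
case: i => [[|[|[|//]]] ?]; case: j => [[|[|[|//]]] ?] //= _; rewrite /third/=.
- by rewrite -[RHS]cos_2pi3 -cosN; congr cos; field.
- by rewrite -[RHS]c2 -cosN; congr cos; field.
- by rewrite -[RHS]cos_2pi3; congr cos; field.
- by rewrite -[RHS]cos_2pi3 -cosN; congr cos; field.
- by rewrite -[RHS]c2; congr cos; field.
- by rewrite -[RHS]cos_2pi3; congr cos; field.
Qed.

End Triangle.

Lemma dot_eq0 (R : realType) d (x : 'cV[R]_d) : (dot x x == 0) = (x == 0).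
Proof.
apply/idP/eqP => [|->]; last first.
  by rewrite /dot big1// => k _; rewrite mxE mul0r.
rewrite psumr_eq0 => [/allP x0|k _]; last exact: sqr_ge0.
apply/colP => k; rewrite mxE; apply/eqP.
by have := x0 k (mem_index_enum _); rewrite mulf_eq0 orbb.
Qed.

(* The squared norm of the sum is 3 + 6 * (- 1/2) = 0. *)
Lemma equiangular_sum0 (R : realType) d (x : 'I_3 -> 'cV[R]_d) :
  (forall i j, dot (x i) (x j) = if i == j then 1 else - 2^-1) ->
  \sum_i x i = 0.
Proof.
move=> xx; apply/eqP; rewrite -dot_eq0 !big_ord_recr big_ord0 /= add0r.
by rewrite !dotE !xx /=; apply/eqP; field.
Qed.

(** * Great circles as solutions *)

Section GreatCircle.
Context {R : realType}.

(** This family is closed under differentiation, which sends (u, v) to (v, -u); hence the second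
    derivative is the negative of the curve. *)
Definition great_circle {d} (u v : 'cV[R]_d) (t : R) := cos t *: u + sin t *: v.

Lemma is_derive_great_circle_coord d (u v : 'cV[R]_d) (t : R) i j :
  is_derive t (1 : R) (fun s => great_circle u v s i j) (great_circle v (- u) t i j).
Proof.
have -> : (fun s => great_circle u v s i j) = u i j \*: cos + v i j \*: sin.
  apply/funext => s; rewrite !mxE !fctE /= /GRing.scale /=.
  by rewrite mulrC [X in _ + X]mulrC.
apply: is_derive_eq; rewrite !mxE /GRing.scale /=; ring.
Qed.

Lemma derivable_great_circle d (u v : 'cV[R]_d) (t : R) :
  derivable (great_circle u v) t 1.
Proof.
apply/derivable_mxP => i j.
exact: (@ex_derive _ _ _ _ _ _ _ (is_derive_great_circle_coord _ _ _ _ _ _)).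
Qed.

Lemma derive1_great_circle d (u v : 'cV[R]_d) :
  derive1 (great_circle u v) = great_circle v (- u).
Proof.
apply/funext => t; rewrite derive1E derive_mx; last exact: derivable_great_circle.
apply/matrixP => i j; rewrite mxE.
exact: (@derive_val _ _ _ _ _ _ _ (is_derive_great_circle_coord _ _ _ _ _ _)).
Qed.

(** The second hypothesis cancels the cos t sin t terms; the first lets cos^2 + sin^2 = 1 remove the
    dependence on t. *)
Lemma dot_great_circle d (u v u' v' : 'cV[R]_d) t :
  dot u u' = dot v v' -> dot u v' + dot v u' = 0 ->
  dot (great_circle u v t) (great_circle u' v' t) = dot u u'.
Proof.
move=> uv /eqP; rewrite addr_eq0 => /eqP uv'.
rewrite !dotE -uv uv' -[RHS]mul1r -(cos2Dsin2 t); ring.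
Qed.

End GreatCircle.

(* The gravitational force on body i is a multiple of
   \sum_(j != i) (q j + q i / 2) = \sum_j q j = 0. *)
Lemma great_circle_solution (R : realType) (u v : 'I_3 -> 'cV[R]_4) :
  (forall i j, dot (u i) (u j) = if i == j then 1 else - 2^-1) ->
  (forall i j, dot (v i) (v j) = if i == j then 1 else - 2^-1) ->
  (forall i j, dot (u i) (v j) + dot (v i) (u j) = 0) ->
  nbody_solution (fun=> 1) (fun i => great_circle (u i) (v i)).
Proof.
move=> uu vv uv.
have qq i j t : dot (great_circle (u i) (v i) t) (great_circle (u j) (v j) t) =
    if i == j then 1 else - 2^-1.
  by rewrite dot_great_circle ?uu ?vv.
split=> [i t|i j t ji|i t|i t].
- by rewrite /sphere3/= qq eqxx.
- by rewrite qq (eq_sym i) (negbTE ji); apply/eqP; lra.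
- by rewrite derive1_great_circle; split; exact: derivable_great_circle.
(* The velocity is again a great circle, so the speed is 1 and the centripetal term equals the
   acceleration; it remains to see that the forces cancel. *)
- rewrite !derive1_great_circle dot_great_circle; last 2 first.
  + by rewrite -scaleN1r !dotE uu vv eqxx; ring.
  + by rewrite -scaleN1r !dotE -mulrDr addrC uv mulr0.
  rewrite vv eqxx.
  set q := fun j => great_circle (u j) (v j) t.
  rewrite (_ : \sum_(j < 3 | j != i) _ = 0); last first.
    (* All pairs have the same inner product, so one common denominator factors out of the sum. *)
    pose c : R := (1 - (- 2^-1) ^+ 2) `^ (3 / 2).
    transitivity (\sum_(j < 3 | j != i) c^-1 *: (q j + 2^-1 *: q i)).
      apply: eq_bigr => j ji; rewrite qq (eq_sym i) (negbTE ji).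
      by rewrite mul1r scaleNr opprK.
    rewrite -scaler_sumr big_split /= sumr_const.
    rewrite (_ : #|_| = 2%N); last by rewrite cardC1 card_ord.
    rewrite scalerMnl -mulr_natr mulVf ?pnatr_eq0//.
    have /eqP := equiangular_sum0 _ _ q (fun i j => qq i j t).
    rewrite (bigD1 i) //= addrC addr_eq0 => /eqP ->.
    by rewrite scale1r addNr scaler0.
  by rewrite /great_circle scale1r sub0r opprD !scalerN.
Qed.

Lemma represents_triangle (R : realType) (s theta : R) : 0 < s ->
  represents_regular_polygon (fun i => s *: cis (theta + third i)).
Proof.
move=> s0; exists 3, (fun i => s *: cis (theta + third i)); split.
  by split=> //; exists 0, s, theta; split=> // j; rewrite add0r.
(* If vertices i and j coincide with i distinct from j, pairing with vertex i gives s^2 = - s^2 / 2,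
   against s > 0. *)
split=> // i j /(congr1 (dot (s *: cis (theta + third i)))).
rewrite !dotE !dot_cis !subrr cos0 opprD addrACA subrr add0r => e.
apply/eqP/negPn/negP => ij; move: e; rewrite cos_third 1?eq_sym//; nra.
Qed.

(** The projections of each body run along ellipses with semi-axes a, b and c, d. Positive semi-axes
    keep the triangles from collapsing to a point. *)
Lemma triangle_rotopulsator (R : realType) (a b c d : R) :
  0 < a -> 0 < b -> 0 < c -> 0 < d -> a ^+ 2 + c ^+ 2 = 1 -> b ^+ 2 + d ^+ 2 = 1 ->
  exists q : 'I_3 -> R -> 'cV[R]_4,
  equal_mass_polygonal_rotopulsator (fun=> 1) q
    (fun _ t => Num.sqrt ((cos t * a) ^+ 2 + (sin t * b) ^+ 2))
    (fun _ t => Num.sqrt ((cos t * c) ^+ 2 + (sin t * d) ^+ 2)).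
Proof.
move=> a0 b0 c0 d0 ac bd.
(* In complex notation [e i] is a cube root of unity w and [f i] is its quarter turn, the product of
   w with the imaginary unit. *)
pose e (i : 'I_3) : 'cV[R]_2 := cis (third i).
pose f (i : 'I_3) : 'cV[R]_2 := cis (third i + pi / 2).
pose u i : 'cV[R]_(2 + 2) := col_mx (a *: e i) (c *: e i).
pose v i : 'cV[R]_(2 + 2) := col_mx (b *: f i) (d *: f i).
pose q i := great_circle (u i) (v i).
have radius_gt0 x y t : 0 < x -> 0 < y ->
    0 < Num.sqrt ((cos t * x) ^+ 2 + (sin t * y) ^+ 2).
  move=> x0 y0; rewrite sqrtr_gt0 lt_def addr_ge0 ?sqr_ge0// andbT.
  rewrite paddr_eq0 ?sqr_ge0// !sqrf_eq0 !mulf_eq0 (gt_eqF x0) (gt_eqF y0) !orbF.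
  apply/negP => /andP[/eqP ct /eqP st].
  by have := cos2Dsin2 t; rewrite ct st expr0n /= addr0 => /eqP; rewrite eq_sym oner_eq0.
have polar_at x y : exists th : R -> R, forall t i,
    (cos t * x) *: e i + (sin t * y) *: f i =
    Num.sqrt ((cos t * x) ^+ 2 + (sin t * y) ^+ 2) *: cis (th t + third i).
  (* The angle is picked by choice, separately at each time. *)
  exists (fun t => sval (cid (polar_coordinates (cos t * x) (sin t * y)))) => t i.
  by case: cid => th /= ->.
have [th thE] := polar_at a b; have [ph phE] := polar_at c d.
have q12 i t : plane12 (q i t) =
    Num.sqrt ((cos t * a) ^+ 2 + (sin t * b) ^+ 2) *: cis (th t + third i).
  rewrite -thE /plane12 /q /great_circle /u /v !scale_col_mx add_col_mx col_mxKu.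
  by rewrite !scalerA.
have q34 i t : plane34 (q i t) =
    Num.sqrt ((cos t * c) ^+ 2 + (sin t * d) ^+ 2) *: cis (ph t + third i).
  rewrite -phE /plane34 /q /great_circle /u /v !scale_col_mx add_col_mx col_mxKd.
  by rewrite !scalerA.
have gram i j : dot (e i) (e j) = if i == j then 1 else - 2^-1.
  rewrite dot_cis; case: eqVneq => [->|ij]; first by rewrite subrr cos0.
  by rewrite cos_third// eq_sym.
exists q; split=> //.
- split=> //.
  + apply: great_circle_solution => i j.
    * by rewrite (@dot_col_mx R 2 2) !dotE gram -[RHS]mul1r -ac; ring.
    * rewrite (@dot_col_mx R 2 2) !dotE.
      have -> : dot (f i) (f j) = dot (e i) (e j).
        by rewrite !dot_cis; congr cos; ring.
      by rewrite gram -[RHS]mul1r -bd; ring.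
    (* The quarter turn from [e] to [f] is skew-symmetric, so the two mixed products are
       opposite. *)
    * rewrite !(@dot_col_mx R 2 2) !dotE.
      have -> : dot (e i) (f j) = - dot (f i) (e j).
        rewrite !dot_cis (_ : third i + _ - _ = (third i - third j) + pi / 2); last by ring.
        rewrite cosDpihalf opprK -cosBpihalf.
        by congr cos; ring.
      by ring.
  + move=> i t; split; rewrite ?sqrtr_ge0// !sqr_sqrtr ?addr_ge0 ?sqr_ge0//.
    rewrite !exprMn -[RHS](cos2Dsin2 t) -[in RHS](mulr1 (cos t ^+ 2)).
    by rewrite -[in RHS](mulr1 (sin t ^+ 2)) -{1}ac -bd; ring.
  + by exists th, ph, third, third.
- move=> t; under eq_fun do rewrite q12.
  exact/represents_triangle/radius_gt0.
- move=> t; under eq_fun do rewrite q34.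
  exact/represents_triangle/radius_gt0.
Qed.

Theorem theorem1p6 (R : realType) :
  (exists (n : nat) (m : 'I_n -> R) (q : 'I_n -> R -> 'cV[R]_4)
          (r rho : 'I_n -> R -> R),
     [/\ (2 <= n)%N,
         equal_mass_polygonal_rotopulsator m q r rho &
         forall i, constant_fun (r i)])
  /\
  (exists (n : nat) (m : 'I_n -> R) (q : 'I_n -> R -> 'cV[R]_4)
          (r rho : 'I_n -> R -> R),
     [/\ (2 <= n)%N,
         equal_mass_polygonal_rotopulsator m q r rho &
         forall i, ~ constant_fun (r i)]).
Proof.
(* The triple 3, 4, 5 supplies rational semi-axes: a = b = 3/5 gives a circle, a = 3/5 and b = 4/5 a
   proper ellipse. *)
have [gt0_3 gt0_4] : 0 < 3 / 5 :> R /\ 0 < 4 / 5 :> R by lra.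
have sq : (3 / 5) ^+ 2 + (4 / 5) ^+ 2 = 1 :> R by field.
split.
- have [q qP] := triangle_rotopulsator _ _ _ _ _ gt0_3 gt0_3 gt0_4 gt0_4 sq sq.
  exists 3, (fun=> 1), q; do 2 eexists; split; [by []|exact: qP|].
  move=> i; exists (3 / 5) => t; rewrite !exprMn -mulrDl cos2Dsin2 mul1r.
  by rewrite -exprMn sqrtr_sqr gtr0_norm.
- have sq' : (4 / 5) ^+ 2 + (3 / 5) ^+ 2 = 1 :> R by rewrite addrC.
  have [q qP] := triangle_rotopulsator _ _ _ _ _ gt0_3 gt0_4 gt0_4 gt0_3 sq sq'.
  exists 3, (fun=> 1), q; do 2 eexists; split; [by []|exact: qP|].
  (* The radius is a = 3/5 at time 0 and b = 4/5 at time pi / 2. *)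
  move=> i [k kE]; have := kE 0; rewrite -(kE (pi / 2)).
  rewrite cos0 sin0 cos_pihalf sin_pihalf !mul0r !mul1r expr0n addr0 add0r.
  by rewrite !sqrtr_sqr !gtr0_norm//; lra.
Qed.
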